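(* The operad $\mathrm{Lie}\text{-}\mathrm{gra}$ is not finitely generated.
   Context: Fix a field $k$ of characteristic $0$. Operads are symmetric, unital, $k$-linear. A *directed simple graph* is a finite non-empty connected graph whose edges are directed, without directed cycles, without external legs, with at most one edge between any two vertices, and with vertices labelled bijectively by $1,\dots,n$ ($n=|\mathsf g|$ the number of vertices). $\mathsf{dsGra}(n)$ is the set of isomorphism classes of those with $n$ vertices. The operad $\mathrm{Lie}\text{-}\mathrm{gra}$ has $\mathrm{Lie}\text{-}\mathrm{gra}(n)=k\,\mathsf{dsGra}(n)$, with symmetric groups permuting labels and unit the one-vertex graph; the partial composition $\mathsf g_1\circ_i\mathsf g_2$ is the sum of all graphs obtained by replacing vertex $i$ of $\mathsf g_1$ by $\mathsf g_2$ and, independently for each edge of $\mathsf g_1$ between a vertex $j$ and $i$, replacing this edge by edges (of the same direction) joining $j$ to all the vertices of some non-empty subset of the vertices of $\mathsf g_2$ (sum over all choices); labels $1,\dots,i-1$ of $\mathsf g_1$ are kept, labels of $\mathsf g_2$ are shifted by $i-1$, remaining labels of $\mathsf g_1$ are shifted by $|\mathsf g_2|-1$. An operad $\mathcal P$ is finitely generated if there is an isomorphism $\mathcal P\cong\mathcal T(E)/(R)$, with $\mathcal T(E)$ the free operad on an $\mathbb S$-module $E$ and $(R)$ an operadic ideal, such that $E$ has finite total dimension. *)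

(* Defs.v *)
From HB Require Import structures.
From mathcomp Require Import all_boot all_fingroup all_algebra.
From mathcomp Require Import generic_quotient boolp zify.

Set Implicit Arguments.
Unset Strict Implicit.
Unset Printing Implicit Defensive.

Import GRing.Theory.

Local Open Scope ring_scope.
Local Open Scope quotient_scope.

(* Right actions: [x . (s o t) = (x . s) . t].  Products in ['S_n] are written
   in diagrammatic order, so that [s o t] is [(t * s)%g]. *)
Record smodule (k : fieldType) := SModule {
  sm_car :> nat -> lmodType k;
  sm_act : forall n : nat, 'S_n -> sm_car n -> sm_car n;
  sm_act_linear : forall n (s : 'S_n), linear (@sm_act n s);
  sm_act1 : forall n (x : sm_car n), sm_act 1%g x = x;
  sm_actM : forall n (s t : 'S_n) (x : sm_car n),
    sm_act t (sm_act s x) = sm_act (t * s)%g x }.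

Record smod_hom (k : fieldType) (E F : smodule k) := SmodHom {
  sh_fun :> forall n : nat, E n -> F n;
  sh_linear : forall n, linear (@sh_fun n);
  sh_act : forall n (s : 'S_n) (x : E n),
    sh_fun (sm_act s x) = sm_act s (sh_fun x) }.

(* Labels start at 0 here.  In a composite [a o_i b] with [a] of arity [m] and
   [b] of arity [n], [place m n i l] tells which input the label [l] comes
   from: [inl j] for the input [j] of [a] (with [j != i]), [inr b] for the
   input [b] of [b]. *)
Definition place (m n r : nat) (i : 'I_m) (l : 'I_r) : 'I_m + 'I_n :=
  if (l < i)%N then inl (insubd i (l : nat))
  else if insub (l - i)%N is Some b then inr b
  else inl (insubd i (l.+1 - n)%N).

(* [rho] is the permutation [s o_i t] of the labels of a composite; it exists
   by [block_perm_exists] and is unique since [place] is injective. *)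
Definition is_block_perm (m n r : nat) (i : 'I_m) (s : 'S_m) (t : 'S_n)
    (rho : 'S_r) : Prop :=
  forall l : 'I_r,
    place n (s i) (rho l) =
    match place n i l with inl j => inl (s j) | inr b => inr (t b) end.

(* Partial compositions [o_i : O m -> O n -> O (m + n - 1)]; the arity of the
   result is a variable [r] with a proof of [r + 1 = m + n], which avoids
   transports along equalities between arities. *)
Record operad (k : fieldType) := Operad {
  op_smod :> smodule k;
  op_unit : op_smod 1%N;
  op_comp : forall m n r : nat, r.+1 = (m + n)%N -> 'I_m ->
    op_smod m -> op_smod n -> op_smod r;
  op_comp_linearl : forall m n r (e : r.+1 = (m + n)%N) (i : 'I_m)
    (b : op_smod n), linear (fun a => op_comp e i a b);
  op_comp_linearr : forall m n r (e : r.+1 = (m + n)%N) (i : 'I_m)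
    (a : op_smod m), linear (op_comp e i a);
  op_unitl : forall n (e : n.+1 = (1 + n)%N) (i : 'I_1) (a : op_smod n),
    op_comp e i op_unit a = a;
  op_unitr : forall m (e : m.+1 = (m + 1)%N) (i : 'I_m) (a : op_smod m),
    op_comp e i a op_unit = a;
  op_sequential : forall m n p r q t (e1 : r.+1 = (m + n)%N)
    (e2 : t.+1 = (r + p)%N) (e3 : q.+1 = (n + p)%N) (e4 : t.+1 = (m + q)%N)
    (i : 'I_m) (j : 'I_n) (j' : 'I_r)
    (a : op_smod m) (b : op_smod n) (c : op_smod p),
    j' = (i + j)%N :> nat ->
    op_comp e2 j' (op_comp e1 i a b) c = op_comp e4 i a (op_comp e3 j b c);
  op_parallel : forall m n p r q t (e1 : r.+1 = (m + n)%N)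
    (e2 : t.+1 = (r + p)%N) (e3 : q.+1 = (m + p)%N) (e4 : t.+1 = (q + n)%N)
    (i j : 'I_m) (j' : 'I_r) (i' : 'I_q)
    (a : op_smod m) (b : op_smod n) (c : op_smod p),
    (i < j)%N -> j'.+1 = (j + n)%N -> i' = i :> nat ->
    op_comp e2 j' (op_comp e1 i a b) c = op_comp e4 i' (op_comp e3 j a c) b;
  op_equivariant : forall m n r (e : r.+1 = (m + n)%N) (i : 'I_m)
    (s : 'S_m) (t : 'S_n) (rho : 'S_r) (a : op_smod m) (b : op_smod n),
    is_block_perm i s t rho ->
    op_comp e i (sm_act s a) (sm_act t b) = sm_act rho (op_comp e (s i) a b) }.

Record operad_hom (k : fieldType) (O Q : operad k) := OperadHom {
  oh_smod :> smod_hom O Q;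
  oh_unit : oh_smod 1%N (op_unit O) = op_unit Q;
  oh_comp : forall m n r (e : r.+1 = (m + n)%N) (i : 'I_m)
    (a : O m) (b : O n),
    oh_smod r (op_comp e i a b) = op_comp e i (oh_smod m a) (oh_smod n b) }.

Definition operad_isomorphic (k : fieldType) (O Q : operad k) : Prop :=
  exists (f : operad_hom O Q) (g : operad_hom Q O),
    forall n, cancel (f n) (g n) /\ cancel (g n) (f n).

Record operad_ideal (k : fieldType) (O : operad k) := OperadIdeal {
  ideal_mem :> forall n : nat, O n -> Prop;
  ideal0 : forall n, ideal_mem (0 : O n);
  ideal_lin : forall n (c : k) (x y : O n),
    ideal_mem x -> ideal_mem y -> ideal_mem (c *: x + y);
  ideal_act : forall n (s : 'S_n) (x : O n),
    ideal_mem x -> ideal_mem (sm_act s x);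
  ideal_compl : forall m n r (e : r.+1 = (m + n)%N) (i : 'I_m)
    (a : O m) (b : O n), ideal_mem a -> ideal_mem (op_comp e i a b);
  ideal_compr : forall m n r (e : r.+1 = (m + n)%N) (i : 'I_m)
    (a : O m) (b : O n), ideal_mem b -> ideal_mem (op_comp e i a b) }.

Section GeneratedIdeal.
Variables (k : fieldType) (O : operad k) (R : forall n, O n -> Prop).

Definition gen_mem (n : nat) (x : O n) : Prop :=
  forall J : operad_ideal O, (forall p (y : O p), R y -> J p y) -> J n x.

Lemma gen_mem0 n : gen_mem (0 : O n).
Proof. by move=> J _; apply: ideal0. Qed.

Lemma gen_mem_lin n (c : k) (x y : O n) :
  gen_mem x -> gen_mem y -> gen_mem (c *: x + y).
Proof. by move=> hx hy J hJ; apply: ideal_lin; [apply: hx | apply: hy]. Qed.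

Lemma gen_mem_act n (s : 'S_n) (x : O n) : gen_mem x -> gen_mem (sm_act s x).
Proof. by move=> hx J hJ; apply: ideal_act; apply: hx. Qed.

Lemma gen_mem_compl m n r (e : r.+1 = (m + n)%N) (i : 'I_m)
  (a : O m) (b : O n) : gen_mem a -> gen_mem (op_comp e i a b).
Proof. by move=> hx J hJ; apply: ideal_compl; apply: hx. Qed.

Lemma gen_mem_compr m n r (e : r.+1 = (m + n)%N) (i : 'I_m)
  (a : O m) (b : O n) : gen_mem b -> gen_mem (op_comp e i a b).
Proof. by move=> hx J hJ; apply: ideal_compr; apply: hx. Qed.

Definition generated_ideal : operad_ideal O :=
  OperadIdeal gen_mem0 gen_mem_lin gen_mem_act gen_mem_compl gen_mem_compr.

End GeneratedIdeal.

Section QuotientOperad.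
Variables (k : fieldType) (O : operad k) (I : operad_ideal O).

Lemma ideal_opp n (x : O n) : I n x -> I n (- x).
Proof. by move=> hx; rewrite -scaleN1r -[_ *: _]addr0; apply: ideal_lin => //; apply: ideal0. Qed.

Lemma ideal_add n (x y : O n) : I n x -> I n y -> I n (x + y).
Proof. by move=> hx hy; rewrite -[x]scale1r; apply: ideal_lin. Qed.

Definition ideal_eq n (x y : O n) : bool := `[< I n (x - y) >].

Lemma ideal_eq_refl n : reflexive (@ideal_eq n).
Proof. by move=> x; apply/asboolP; rewrite subrr; apply: ideal0. Qed.

Lemma ideal_eq_sym n : symmetric (@ideal_eq n).
Proof.
by move=> x y; apply/asboolP/asboolP => /ideal_opp; rewrite opprB.
Qed.

Lemma ideal_eq_trans n : transitive (@ideal_eq n).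
Proof.
move=> y x z /asboolP h1 /asboolP h2; apply/asboolP.
by rewrite -(subrKA y); apply: ideal_add.
Qed.

Canonical ideal_equiv n :=
  EquivRel (@ideal_eq n) (@ideal_eq_refl n) (@ideal_eq_sym n) (@ideal_eq_trans n).

Definition quot_car (n : nat) : Type := {eq_quot (@ideal_equiv n)}.
HB.instance Definition _ n := Choice.on (quot_car n).

Definition qpi n (x : O n) : quot_car n := \pi_({eq_quot (@ideal_equiv n)}) x.
Definition qrepr n (x : quot_car n) : O n :=
  repr (x : {eq_quot (@ideal_equiv n)}).

Lemma qpiK n (x : quot_car n) : qpi (qrepr x) = x.
Proof. exact: reprK. Qed.

Lemma qpiP n (x y : O n) : I n (x - y) <-> qpi x = qpi y.
Proof.
split=> [h|/eqmodP /= h].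
  by apply/eqmodP; apply/asboolP.
exact/asboolP.
Qed.

Lemma qreprP n (x : O n) : I n (qrepr (qpi x) - x).
Proof. by apply/qpiP; rewrite qpiK. Qed.

Definition qadd n (x y : quot_car n) := qpi (qrepr x + qrepr y).
Definition qopp n (x : quot_car n) := qpi (- qrepr x).
Definition qscale n (c : k) (x : quot_car n) := qpi (c *: qrepr x).

Lemma ideal_scale n c (x : O n) : I n x -> I n (c *: x).
Proof. by move=> hx; rewrite -[_ *: _]addr0; apply: ideal_lin => //; apply: ideal0. Qed.

Lemma qpiD n (x y : O n) : qadd (qpi x) (qpi y) = qpi (x + y).
Proof.
apply/qpiP; rewrite opprD addrACA.
by apply: ideal_add; apply: qreprP.
Qed.

Lemma qpiN n (x : O n) : qopp (qpi x) = qpi (- x).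
Proof. by apply/qpiP; rewrite -opprD; apply: ideal_opp; apply: qreprP. Qed.

Lemma qpiZ n c (x : O n) : qscale c (qpi x) = qpi (c *: x).
Proof. by apply/qpiP; rewrite -scalerBr; apply: ideal_scale; apply: qreprP. Qed.

Lemma qind n (P : quot_car n -> Prop) : (forall x, P (qpi x)) -> forall x, P x.
Proof. by move=> h x; rewrite -(qpiK x); apply: h. Qed.

Lemma qaddA n : associative (@qadd n).
Proof.
by elim/qind=> x; elim/qind=> y; elim/qind=> z; rewrite !qpiD addrA.
Qed.
Lemma qaddC n : commutative (@qadd n).
Proof. by elim/qind=> x; elim/qind=> y; rewrite !qpiD addrC. Qed.
Lemma qadd0 n : left_id (qpi (0 : O n)) (@qadd n).
Proof. by elim/qind=> x; rewrite qpiD add0r. Qed.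
Lemma qaddN n : left_inverse (qpi (0 : O n)) (@qopp n) (@qadd n).
Proof. by elim/qind=> x; rewrite qpiN qpiD addNr. Qed.

HB.instance Definition _ n := GRing.isZmodule.Build (quot_car n)
  (@qaddA n) (@qaddC n) (@qadd0 n) (@qaddN n).

Lemma qscaleA n a b (x : quot_car n) : qscale a (qscale b x) = qscale (a * b) x.
Proof. by elim/qind: x => x; rewrite !qpiZ scalerA. Qed.
Lemma qscale1 n : left_id 1 (@qscale n).
Proof. by elim/qind=> x; rewrite !qpiZ scale1r. Qed.
Lemma qscaleDr n : right_distributive (@qscale n) +%R.
Proof.
by move=> a; elim/qind=> x; elim/qind=> y; rewrite /GRing.add/= !(qpiZ, qpiD) scalerDr.
Qed.
Lemma qscaleDl n (x : quot_car n) : {morph (@qscale n)^~ x : a b / a + b}.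
Proof.
by move=> a b; elim/qind: x => x; rewrite [RHS]/GRing.add/= !(qpiZ, qpiD) scalerDl.
Qed.

HB.instance Definition _ n := GRing.Zmodule_isLmodule.Build k (quot_car n)
  (@qscaleA n) (@qscale1 n) (@qscaleDr n) (@qscaleDl n).

Lemma qpi_linear n : linear (@qpi n : O n -> quot_car n).
Proof. by move=> c x y; rewrite -qpiD -qpiZ. Qed.

Definition qact n (s : 'S_n) (x : quot_car n) : quot_car n :=
  qpi (sm_act s (qrepr x)).
Definition qcomp m n r (e : r.+1 = (m + n)%N) (i : 'I_m)
    (a : quot_car m) (b : quot_car n) : quot_car r :=
  qpi (op_comp e i (qrepr a) (qrepr b)).

Lemma linear_sub (U V : lmodType k) (f : U -> V) :
  linear f -> forall x y, f (x - y) = f x - f y.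
Proof. by move=> h x y; rewrite -scaleN1r addrC h scaleN1r addrC. Qed.

Lemma qpi_act n (s : 'S_n) (x : O n) : qact s (qpi x) = qpi (sm_act s x).
Proof.
apply/qpiP; rewrite -(linear_sub (sm_act_linear s)).
by apply: ideal_act; apply: qreprP.
Qed.

Lemma qpi_comp m n r (e : r.+1 = (m + n)%N) (i : 'I_m) (a : O m) (b : O n) :
  qcomp e i (qpi a) (qpi b) = qpi (op_comp e i a b).
Proof.
apply/qpiP; rewrite -(subrKA (op_comp e i a (qrepr (qpi b)))).
rewrite -(linear_sub (op_comp_linearr e i a)).
rewrite -(linear_sub (op_comp_linearl e i _)).
by apply: ideal_add; [apply: ideal_compl|apply: ideal_compr]; apply: qreprP.
Qed.

Lemma qact_linear n (s : 'S_n) : linear (@qact n s).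
Proof.
move=> c; elim/qind=> x; elim/qind=> y.
by rewrite -qpi_linear !qpi_act sm_act_linear qpi_linear.
Qed.
Lemma qact1 n (x : quot_car n) : qact 1%g x = x.
Proof. by elim/qind: x => x; rewrite qpi_act sm_act1. Qed.
Lemma qactM n (s t : 'S_n) (x : quot_car n) : qact t (qact s x) = qact (t * s)%g x.
Proof. by elim/qind: x => x; rewrite !qpi_act sm_actM. Qed.

Definition quotient_smodule : smodule k :=
  @SModule k (fun n => quot_car n : lmodType k) qact qact_linear qact1 qactM.

Lemma qcomp_linearl m n r (e : r.+1 = (m + n)%N) (i : 'I_m)
  (b : quotient_smodule n) :
  linear (fun a : quotient_smodule m => qcomp e i a b : quotient_smodule r).
Proof.
elim/qind: b => b c; elim/qind=> x; elim/qind=> y.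
by rewrite -qpi_linear !qpi_comp op_comp_linearl qpi_linear.
Qed.

Lemma qcomp_linearr m n r (e : r.+1 = (m + n)%N) (i : 'I_m)
  (a : quotient_smodule m) :
  linear (qcomp e i a : quotient_smodule n -> quotient_smodule r).
Proof.
elim/qind: a => a c; elim/qind=> x; elim/qind=> y.
by rewrite -qpi_linear !qpi_comp op_comp_linearr qpi_linear.
Qed.

Definition quotient_operad : operad k.
Proof.
apply: (@Operad k quotient_smodule (qpi (op_unit O)) qcomp).
- exact: qcomp_linearl.
- exact: qcomp_linearr.
- by move=> n e i; elim/qind=> a; rewrite qpi_comp op_unitl.
- by move=> m e i; elim/qind=> a; rewrite qpi_comp op_unitr.
- move=> m n p r q t e1 e2 e3 e4 i j j'.
  elim/qind=> a; elim/qind=> b; elim/qind=> c h.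
  by rewrite !qpi_comp (op_sequential e1 e2 e3 e4 a b c h).
- move=> m n p r q t e1 e2 e3 e4 i j j' i'.
  elim/qind=> a; elim/qind=> b; elim/qind=> c h1 h2 h3.
  by rewrite !qpi_comp (op_parallel e1 e2 e3 e4 a b c h1 h2 h3).
- move=> m n r e i s t rho; elim/qind=> a; elim/qind=> b h.
  change (qcomp e i (qact s (qpi a)) (qact t (qpi b)) =
          qact rho (qcomp e (s i) (qpi a) (qpi b))).
  rewrite (qpi_act s a) (qpi_act t b) !qpi_comp.
  by rewrite (op_equivariant e a b h) qpi_act.
Defined.

End QuotientOperad.

Section FreeOperad.
Variables (k : fieldType) (E : smodule k).

Inductive free_term : nat -> Type :=
| FGen n : E n -> free_term n
| FUnit : free_term 1
| FComp m n r : r.+1 = (m + n)%N -> 'I_m ->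
    free_term m -> free_term n -> free_term r
| FAct n : 'S_n -> free_term n -> free_term n
| FZero n : free_term n
| FAdd n : free_term n -> free_term n -> free_term n
| FScale n : k -> free_term n -> free_term n.

Fixpoint free_eval (O : operad k) (f : smod_hom E O) n (x : free_term n) :
    O n :=
  match x in free_term n return O n with
  | FGen n g => f n g
  | FUnit => op_unit O
  | FComp m n r e i a b => op_comp e i (free_eval f a) (free_eval f b)
  | FAct n s a => sm_act s (free_eval f a)
  | FZero n => 0
  | FAdd n a b => free_eval f a + free_eval f b
  | FScale n c a => c *: free_eval f a
  end.

(* Two expressions are identified when they have the same value in all operads
   receiving a map from [E], i.e. when they are equal modulo the axioms of
   operads and the relations expressing that [E -> T(E)] is a map of
   S-modules.  The universal property is [free_lift_gen] and [free_lift_unique]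
   below. *)
Definition free_eq n (x y : free_term n) : bool :=
  `[< forall (O : operad k) (f : smod_hom E O), free_eval f x = free_eval f y >].

HB.instance Definition _ n := gen_eqMixin (free_term n).
HB.instance Definition _ n := gen_choiceMixin (free_term n).

Lemma free_eq_refl n : reflexive (@free_eq n).
Proof. by move=> x; apply/asboolP. Qed.

Lemma free_eq_sym n : symmetric (@free_eq n).
Proof. by move=> x y; apply/asboolP/asboolP => h O f; rewrite h. Qed.

Lemma free_eq_trans n : transitive (@free_eq n).
Proof.
by move=> y x z /asboolP h1 /asboolP h2; apply/asboolP => O f; rewrite h1 h2.
Qed.

Canonical free_equiv n :=
  EquivRel (@free_eq n) (@free_eq_refl n) (@free_eq_sym n) (@free_eq_trans n).

Definition free_car (n : nat) : Type := {eq_quot (@free_equiv n)}.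
HB.instance Definition _ n := Choice.on (free_car n).

Definition fpi n (x : free_term n) : free_car n :=
  \pi_({eq_quot (@free_equiv n)}) x.
Definition frepr n (x : free_car n) : free_term n :=
  repr (x : {eq_quot (@free_equiv n)}).

Definition feval (O : operad k) (f : smod_hom E O) n (x : free_car n) : O n :=
  free_eval f (frepr x).

Lemma feval_pi (O : operad k) (f : smod_hom E O) n (x : free_term n) :
  feval f (fpi x) = free_eval f x.
Proof.
have : fpi (frepr (fpi x)) = fpi x by exact: reprK.
by move=> /eqmodP /= /asboolP; apply.
Qed.

Lemma feval_inj n (x y : free_car n) :
  (forall (O : operad k) (f : smod_hom E O), feval f x = feval f y) -> x = y.
Proof.
move=> h; suff : fpi (frepr x) = fpi (frepr y).
  by rewrite /fpi /frepr !reprK.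
by apply/eqmodP; apply/asboolP.
Qed.

Definition fadd n (x y : free_car n) := fpi (FAdd (frepr x) (frepr y)).
Definition fopp n (x : free_car n) := fpi (FScale (-1) (frepr x)).
Definition fscale n (c : k) (x : free_car n) := fpi (FScale c (frepr x)).
Definition fzero n : free_car n := fpi (FZero n).
Definition fact n (s : 'S_n) (x : free_car n) : free_car n :=
  fpi (FAct s (frepr x)).
Definition funit : free_car 1 := fpi FUnit.
Definition fcomp m n r (e : r.+1 = (m + n)%N) (i : 'I_m)
    (a : free_car m) (b : free_car n) : free_car r :=
  fpi (FComp e i (frepr a) (frepr b)).

Lemma fevalD (O : operad k) (f : smod_hom E O) n (x y : free_car n) :
  feval f (fadd x y) = feval f x + feval f y.
Proof. by rewrite feval_pi. Qed.
Lemma fevalN (O : operad k) (f : smod_hom E O) n (x : free_car n) :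
  feval f (fopp x) = - feval f x.
Proof. by rewrite feval_pi /= scaleN1r. Qed.
Lemma fevalZ (O : operad k) (f : smod_hom E O) n c (x : free_car n) :
  feval f (fscale c x) = c *: feval f x.
Proof. by rewrite feval_pi. Qed.
Lemma feval0 (O : operad k) (f : smod_hom E O) n : feval f (fzero n) = 0.
Proof. by rewrite feval_pi. Qed.
Lemma feval_act (O : operad k) (f : smod_hom E O) n (s : 'S_n) (x : free_car n) :
  feval f (fact s x) = sm_act s (feval f x).
Proof. by rewrite feval_pi. Qed.
Lemma feval_unit (O : operad k) (f : smod_hom E O) : feval f funit = op_unit O.
Proof. by rewrite feval_pi. Qed.
Lemma feval_comp (O : operad k) (f : smod_hom E O) m n r
  (e : r.+1 = (m + n)%N) (i : 'I_m) (a : free_car m) (b : free_car n) :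
  feval f (fcomp e i a b) = op_comp e i (feval f a) (feval f b).
Proof. by rewrite feval_pi. Qed.

Lemma faddA n : associative (@fadd n).
Proof. by move=> x y z; apply: feval_inj => O f; rewrite !fevalD addrA. Qed.
Lemma faddC n : commutative (@fadd n).
Proof. by move=> x y; apply: feval_inj => O f; rewrite !fevalD addrC. Qed.
Lemma fadd0 n : left_id (fzero n) (@fadd n).
Proof. by move=> x; apply: feval_inj => O f; rewrite fevalD feval0 add0r. Qed.
Lemma faddN n : left_inverse (fzero n) (@fopp n) (@fadd n).
Proof.
by move=> x; apply: feval_inj => O f; rewrite fevalD fevalN feval0 addNr.
Qed.

HB.instance Definition _ n := GRing.isZmodule.Build (free_car n)
  (@faddA n) (@faddC n) (@fadd0 n) (@faddN n).

Lemma fscaleA n a b (x : free_car n) : fscale a (fscale b x) = fscale (a * b) x.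
Proof. by apply: feval_inj => O f; rewrite !fevalZ scalerA. Qed.
Lemma fscale1 n : left_id 1 (@fscale n).
Proof. by move=> x; apply: feval_inj => O f; rewrite fevalZ scale1r. Qed.
Lemma fscaleDr n : right_distributive (@fscale n) +%R.
Proof.
move=> a x y; apply: feval_inj => O f.
by rewrite /GRing.add /= !(fevalZ, fevalD) scalerDr.
Qed.
Lemma fscaleDl n (x : free_car n) : {morph (@fscale n)^~ x : a b / a + b}.
Proof.
move=> a b; apply: feval_inj => O f.
by rewrite [in RHS]/GRing.add /= !(fevalZ, fevalD) scalerDl.
Qed.

HB.instance Definition _ n := GRing.Zmodule_isLmodule.Build k (free_car n)
  (@fscaleA n) (@fscale1 n) (@fscaleDr n) (@fscaleDl n).

Lemma feval_linear (O : operad k) (f : smod_hom E O) n :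
  linear (@feval O f n : free_car n -> O n).
Proof. by move=> c x y; rewrite -fevalZ -fevalD. Qed.

Lemma fact_linear n (s : 'S_n) : linear (@fact n s).
Proof.
move=> c x y; apply: feval_inj => O f.
by rewrite feval_linear !feval_act feval_linear sm_act_linear.
Qed.
Lemma fact1 n (x : free_car n) : fact 1%g x = x.
Proof. by apply: feval_inj => O f; rewrite feval_act sm_act1. Qed.
Lemma factM n (s t : 'S_n) (x : free_car n) :
  fact t (fact s x) = fact (t * s)%g x.
Proof. by apply: feval_inj => O f; rewrite !feval_act sm_actM. Qed.

Definition free_smodule : smodule k :=
  @SModule k (fun n => free_car n : lmodType k) fact fact_linear fact1 factM.

Lemma fcomp_linearl m n r (e : r.+1 = (m + n)%N) (i : 'I_m)
  (b : free_smodule n) :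
  linear (fun a : free_smodule m => fcomp e i a b : free_smodule r).
Proof.
move=> c x y; apply: feval_inj => O f.
by rewrite feval_linear !feval_comp feval_linear op_comp_linearl.
Qed.

Lemma fcomp_linearr m n r (e : r.+1 = (m + n)%N) (i : 'I_m)
  (a : free_smodule m) :
  linear (fcomp e i a : free_smodule n -> free_smodule r).
Proof.
move=> c x y; apply: feval_inj => O f.
by rewrite feval_linear !feval_comp feval_linear op_comp_linearr.
Qed.

Definition free_operad : operad k.
Proof.
apply: (@Operad k free_smodule funit fcomp).
- exact: fcomp_linearl.
- exact: fcomp_linearr.
- move=> n e i a; apply: feval_inj => O f.
  by rewrite feval_comp feval_unit op_unitl.
- move=> m e i a; apply: feval_inj => O f.
  by rewrite feval_comp feval_unit op_unitr.
- move=> m n p r q t e1 e2 e3 e4 i j j' a b c h; apply: feval_inj => O f.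
  by rewrite !feval_comp (op_sequential e1 e2 e3 e4 _ _ _ h).
- move=> m n p r q t e1 e2 e3 e4 i j j' i' a b c h1 h2 h3.
  apply: feval_inj => O f.
  by rewrite !feval_comp (op_parallel e1 e2 e3 e4 _ _ _ h1 h2 h3).
- move=> m n r e i s t rho a b h; apply: feval_inj => O f.
  rewrite /= feval_act !feval_comp !feval_act.
  exact: op_equivariant.
Defined.

Definition free_gen_fun n (x : E n) : free_operad n := fpi (FGen x).

Lemma free_gen_linear n : linear (@free_gen_fun n).
Proof.
move=> c x y; apply: feval_inj => O f.
by rewrite feval_linear !feval_pi /= sh_linear.
Qed.

Lemma free_gen_act n (s : 'S_n) (x : E n) :
  free_gen_fun (sm_act s x) = sm_act s (free_gen_fun x).
Proof.
by apply: feval_inj => O f; rewrite feval_act !feval_pi /= sh_act.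
Qed.

Definition free_gen : smod_hom E free_operad :=
  SmodHom free_gen_linear free_gen_act.

Section Lift.
Variables (O : operad k) (f : smod_hom E O).

Definition free_lift_smod : smod_hom free_operad O :=
  @SmodHom k free_operad O (@feval O f) (@feval_linear O f) (@feval_act O f).

Definition free_lift : operad_hom free_operad O :=
  @OperadHom k free_operad O free_lift_smod (@feval_unit O f) (@feval_comp O f).

Lemma free_lift_gen n (x : E n) : free_lift n (free_gen n x) = f n x.
Proof. exact: feval_pi. Qed.

Lemma free_lift_unique (g : operad_hom free_operad O) :
  (forall n (x : E n), g n (free_gen n x) = f n x) ->
  forall n (x : free_operad n), g n x = free_lift n x.
Proof.
move=> hg n x; suff h (t : free_term n) : g n (fpi t) = free_eval f t.
  have xK : fpi (frepr x) = x by exact: reprK.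
  by rewrite -{1}xK h.
have g0 p : g p 0 = 0.
  by have := sh_linear g (-1) (0 : free_operad p) 0; rewrite !scaleN1r !addNr.
elim: t => {n x} /=.
- by move=> n x; apply: hg.
- exact: (oh_unit g).
- move=> m n r e i a <- b <-; rewrite -(oh_comp g e i (fpi a) (fpi b)); congr (g r _).
  by apply: feval_inj => Q q; rewrite feval_comp !feval_pi.
- move=> n s a <-; rewrite -(sh_act g s (fpi a)); congr (g n _).
  by apply: feval_inj => Q q; rewrite feval_act !feval_pi.
- by move=> n; rewrite -(g0 n).
- move=> n a <- b <-; rewrite -[g n (fpi a)]scale1r -(sh_linear g 1 (fpi a) (fpi b)); congr (g n _).
  by apply: feval_inj => Q q; rewrite feval_linear !feval_pi scale1r.
- move=> n c a <-; rewrite -[RHS]addr0 -(g0 n) -(sh_linear g c (fpi a) 0); congr (g n _).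
  by apply: feval_inj => Q q; rewrite feval_linear !feval_pi /= addr0.
Qed.

End Lift.
End FreeOperad.

Definition finite_total_dimension (k : fieldType) (E : smodule k) : Prop :=
  exists d : nat -> nat,
    (forall n, inhabited (Vector.axiom (d n) (E n))) /\
    (exists N : nat, forall n, (N < n)%N -> d n = 0%N).

Definition finitely_generated (k : fieldType) (P : operad k) : Prop :=
  exists (E : smodule k) (R : forall n, free_operad E n -> Prop),
    finite_total_dimension E /\
    operad_isomorphic P (quotient_operad (generated_ideal R)).

(* A labelled directed graph on ['I_n] is given by its set of edges.  The last
   condition excludes an edge [x -> y] together with a directed path from [y]
   to [x], i.e. all directed cycles; those of length 1 and 2 are the loops and
   the pairs of opposite edges, so that there is at most one edge between two
   vertices. *)
Definition is_dsgraph (n : nat) (G : {set 'I_n * 'I_n}) : bool :=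
  [&& (0 < n)%N,
      [forall x, forall y,
         connect (fun u v => ((u, v) \in G) || ((v, u) \in G)) x y] &
      [forall x, forall y,
         ((x, y) \in G) ==> ~~ connect (fun u v => (u, v) \in G) y x]].

Definition dsGra (n : nat) := {G : {set 'I_n * 'I_n} | is_dsgraph G}.

Definition relabel (n : nat) (s : 'S_n) (G : {set 'I_n * 'I_n}) :
    {set 'I_n * 'I_n} :=
  [set p | (s p.1, s p.2) \in G].

(* [S j] is the set of vertices of the inserted graph that get joined to [j];
   it is empty when [j] is not adjacent to [i]. *)
Definition attaching (m n : nat) (G1 : {set 'I_m * 'I_m}) (i : 'I_m)
    (S : {ffun 'I_m -> {set 'I_n}}) : bool :=
  [forall j, (S j != set0) == (((j, i) \in G1) || ((i, j) \in G1))].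

Definition insert_graph (m n r : nat) (i : 'I_m) (G1 : {set 'I_m * 'I_m})
    (G2 : {set 'I_n * 'I_n}) (S : {ffun 'I_m -> {set 'I_n}}) :
    {set 'I_r * 'I_r} :=
  [set p | match place n i p.1, place n i p.2 with
           | inl j, inl j' => (j, j') \in G1
           | inl j, inr b => ((j, i) \in G1) && (b \in S j)
           | inr b, inl j => ((i, j) \in G1) && (b \in S j)
           | inr b, inr b' => (b, b') \in G2
           end].


Definition proj (m n r : nat) (i : 'I_m) (l : 'I_r) : 'I_m :=
  if place n i l is inl j then j else i.

Section Labels.
Variables (m n r : nat) (e : r.+1 = (m + n)%N) (i : 'I_m).

Lemma inn_subproof (b : 'I_n) : (i + b < r)%N.
Proof. by case: i b => i' hi [b hb] /=; lia. Qed.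

Definition inn (b : 'I_n) : 'I_r := Ordinal (inn_subproof b).

Variant place_spec (l : 'I_r) : 'I_m + 'I_n -> 'I_m -> Type :=
| PlaceLow (j : 'I_m) of (l < i)%N & j = l :> nat : place_spec l (inl j) j
| PlaceIn (b : 'I_n) of l = inn b : place_spec l (inr b) i
| PlaceHigh (j : 'I_m) of (i + n <= l)%N & (j + n = l.+1)%N : place_spec l (inl j) j.

Lemma placeP (l : 'I_r) : place_spec l (place n i l) (proj n i l).
Proof.
rewrite /proj /place; case: ltnP => hli.
  have hm : (l < m)%N by case: i hli => i' hi /=; lia.
  by apply: PlaceLow => //; rewrite val_insubd hm.
case: insubP => [b hb eb|hb].
  by apply: PlaceIn; apply: val_inj; rewrite /= eb; lia.
have hm : (l.+1 - n < m)%N by case: l hli hb => l hl /=; lia.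
by apply: PlaceHigh; rewrite ?val_insubd ?hm; lia.
Qed.

Lemma proj_val (l : 'I_r) : proj n i l =
  (if (l < i)%N then l : nat else if (l < i + n)%N then i : nat else l.+1 - n)%N
  :> nat.
Proof.
case: placeP => [j h1 h2|b ->|j h1 h2] /=; last first.
- by rewrite ifF ?ifF; lia.
- by case: b => b hb /=; rewrite ifF ?ifT; lia.
by rewrite h1.
Qed.

Lemma place_inl (l : 'I_r) (j : 'I_m) :
  place n i l = inl j <-> proj n i l = j /\ j != i.
Proof.
case: placeP => [j' h1 h2|b _|j' h1 h2]; split.
- by case=> <-; split=> //; apply/eqP => /(congr1 val) /=; lia.
- by case=> ->.
- by [].
- by case=> -> /eqP.
- by case=> <-; split=> //; apply/eqP => /(congr1 val) /=; lia.
- by case=> ->.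
Qed.

Lemma place_inr (l : 'I_r) (b : 'I_n) : place n i l = inr b <-> l = inn b.
Proof.
case: placeP => [j' h1 h2|b' ->|j' h1 h2]; split=> //.
- by move=> eb; move: h1; rewrite eb /=; lia.
- by case=> ->.
- by move/(congr1 val) => /= /addnI/val_inj ->.
- by move=> eb; move: h1; rewrite eb /=; case: b eb => b hb _ /=; lia.
Qed.

Lemma place_inn b : place n i (inn b) = inr b.
Proof. exact/place_inr. Qed.

Lemma inn_inj : injective inn.
Proof. by move=> b c /(congr1 val) /= /addnI/val_inj. Qed.

Lemma proj_inn b : proj n i (inn b) = i.
Proof. by rewrite /proj place_inn. Qed.

Lemma proj_eq (l : 'I_r) : proj n i l = i -> exists b, l = inn b.
Proof.
case: placeP => [j h1 h2 E|b -> _|j h1 h2 E]; last 1 first.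
- by move: h1 h2; rewrite E; case: (i) => /=; lia.
- by move: h1 h2; rewrite E; case: (i) => /=; lia.
by exists b.
Qed.

Lemma proj_inj (x y : 'I_r) :
  proj n i x != i -> proj n i x = proj n i y -> x = y.
Proof.
move=> h E; have h2 : proj n i y != i by rewrite -E.
have {}E := congr1 val E.
move: h h2; rewrite -!val_eqE /= => h h2.
move: E h h2; rewrite /= !proj_val => E h h2.
apply: val_inj => /=; move: E h h2.
case: (ltnP x i); case: (ltnP x (i + n)); case: (ltnP y i); case: (ltnP y (i + n)); lia.
Qed.

Lemma proj_surj (j : 'I_m) : j != i -> exists x : 'I_r, proj n i x = j.
Proof.
rewrite -val_eqE /= => hj.
have h : ((if (j < i)%N then j : nat else (j + n).-1) < r)%N.
  move: hj; case: (ltnP j i); case: (i) (j) => i' hi [j' hj'] /=; lia.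
exists (Ordinal h); apply: val_inj; rewrite /= proj_val /=.
move: hj; case: (ltnP j i) => h1 hj; first by rewrite h1.
by rewrite ifF ?ifF; lia.
Qed.

End Labels.

Lemma placeE m n r (e : r.+1 = (m + n)%N) (i : 'I_m) (l : 'I_r) u :
  place n i l = u <->
  match u with inl j => proj n i l = j /\ j != i | inr b => l = inn e i b end.
Proof. by case: u => [j|b]; [apply: place_inl|apply: place_inr]. Qed.

Lemma place_inj m n r (e : r.+1 = (m + n)%N) (i : 'I_m) :
  injective (@place m n r i).
Proof.
move=> x y /(placeE e); case E : (place n i y) => [j|b].
  case=> h1 h2; move/(place_inl e): E => [h3 _].
  by apply: (proj_inj e (i := i)); rewrite h1 // -h3.
by move=> ->; move/(place_inr e): E => ->.
Qed.

Lemma block_perm_exists m n r (e : r.+1 = (m + n)%N) (i : 'I_m)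
  (s : 'S_m) (t : 'S_n) : exists rho : 'S_r, is_block_perm i s t rho.
Proof.
pose f u : 'I_m + 'I_n :=
  match u with inl j => inl (s j) | inr b => inr (t b) end.
have ex (l : 'I_r) : exists x : 'I_r, place n (s i) x == f (place n i l).
  case E : (place n i l) => [j|b] /=.
    move/(place_inl e): E => [_ hj].
    have [|x hx] := @proj_surj m n r e (s i) (s j).
      by rewrite (inj_eq perm_inj).
    by exists x; apply/eqP/(place_inl e); rewrite (inj_eq perm_inj).
  by exists (inn e (s i) (t b)); rewrite place_inn.
pose g l := xchoose (ex l).
have gP l : place n (s i) (g l) = f (place n i l) by apply/eqP/(xchooseP (ex l)).
have g_inj : injective g.
  move=> x y E; apply: (place_inj e (i := i)); have := gP x; rewrite E gP.
  by case: (place n i x) (place n i y) => [u|u] [v|v] //= [] /perm_inj ->.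
by exists (perm g_inj) => l; rewrite permE gP.
Qed.

Definition contr (p q : nat) (f : 'I_p -> 'I_q) (G : {set 'I_p * 'I_p}) :
    {set 'I_q * 'I_q} :=
  [set u | (u.1 != u.2) &&
     [exists x, exists y, [&& f x == u.1, f y == u.2 & (x, y) \in G]]].

Definition restr (p q : nat) (f : 'I_q -> 'I_p) (G : {set 'I_p * 'I_p}) :
    {set 'I_q * 'I_q} := [set u | (f u.1, f u.2) \in G].

Definition loopless n (G : {set 'I_n * 'I_n}) := forall x, (x, x) \notin G.

Lemma contrP p q (f : 'I_p -> 'I_q) (G : {set 'I_p * 'I_p}) u v :
  reflect (u <> v /\ exists x y, [/\ f x = u, f y = v & (x, y) \in G])
    ((u, v) \in contr f G).
Proof.
rewrite inE /=; apply: (iffP andP) => [[/eqP h /existsP[x /existsP[y]]]|].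
  by case/and3P=> /eqP h1 /eqP h2 h3; split=> //; exists x, y.
case=> /eqP h [x [y [h1 h2 h3]]]; split=> //.
by apply/existsP; exists x; apply/existsP; exists y; rewrite h1 h2 h3 !eqxx.
Qed.

Lemma restrE p q (f : 'I_q -> 'I_p) (G : {set 'I_p * 'I_p}) u v :
  ((u, v) \in restr f G) = ((f u, f v) \in G).
Proof. by rewrite inE. Qed.

Lemma loopless_contr p q (f : 'I_p -> 'I_q) G : loopless (contr f G).
Proof. by move=> x; apply/negP => /contrP[]. Qed.

Lemma loopless_restr p q (f : 'I_q -> 'I_p) G : loopless G -> loopless (restr f G).
Proof. by move=> h x; rewrite restrE. Qed.

Lemma setP2 (p : nat) (A B : {set 'I_p * 'I_p}) :
  (forall x y, (x, y) \in A <-> (x, y) \in B) -> A = B.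
Proof. by move=> h; apply/setP=> -[x y]; apply/idP/idP => /h. Qed.

Lemma contr_comp p q s (f : 'I_q -> 'I_s) (g : 'I_p -> 'I_q) (h : 'I_p -> 'I_s) G :
  (forall x, f (g x) = h x) -> contr f (contr g G) = contr h G.
Proof.
move=> E; apply: setP2 => u v; split=> /contrP[huv].
  case=> x [y [hx hy /contrP[hxy [x' [y' [hx' hy' hG]]]]]].
  by apply/contrP; split=> //; exists x', y'; rewrite -!E hx' hy'.
case=> x [y [hx hy hG]]; apply/contrP; split=> //.
exists (g x), (g y); rewrite !E; split=> //; apply/contrP; split.
  by move=> hg; apply: huv; rewrite -hx -hy -!E hg.
by exists x, y.
Qed.

Lemma restr_comp p q s (f : 'I_q -> 'I_p) (g : 'I_s -> 'I_q) (h : 'I_s -> 'I_p) G :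
  (forall x, f (g x) = h x) -> restr g (restr f G) = restr h G.
Proof. by move=> E; apply: setP2 => u v; rewrite !restrE !E. Qed.

Lemma restr_contr p q s t (f : 'I_p -> 'I_q) (g : 'I_s -> 'I_q)
  (f' : 'I_t -> 'I_s) (g' : 'I_t -> 'I_p) G :
  injective g -> (forall x, f (g' x) = g (f' x)) ->
  (forall x y, f x = g y -> exists z, x = g' z) ->
  restr g (contr f G) = contr f' (restr g' G).
Proof.
move=> gi E pb; apply: setP2 => u v; rewrite restrE; split=> /contrP[huv].
  case=> x [y [hx hy hG]]; apply/contrP; split=> [euv|].
    by apply: huv; rewrite euv.
  have [x' ex] := pb _ _ hx; have [y' ey] := pb _ _ hy.
  exists x', y'; rewrite restrE -ex -ey; split=> //.
    by apply: gi; rewrite -E -ex.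
  by apply: gi; rewrite -E -ey.
case=> x [y [hx hy]]; rewrite restrE => hG; apply/contrP; split=> [/gi //|].
by exists (g' x), (g' y); rewrite !E hx hy.
Qed.

Lemma contr_id p (f : 'I_p -> 'I_p) G :
  (forall x, f x = x) -> loopless G -> contr f G = G.
Proof.
move=> E hG; apply: setP2 => u v; split=> [/contrP[_ [x [y []]]]|h].
  by rewrite !E => -> ->.
apply/contrP; split=> [euv|]; last by exists u, v; rewrite !E.
by move: (hG v); rewrite -{1}euv h.
Qed.

Section IsDsgraph.

Definition und n (G : {set 'I_n * 'I_n}) :=
  fun u v : 'I_n => ((u, v) \in G) || ((v, u) \in G).
Definition edg n (G : {set 'I_n * 'I_n}) := fun u v : 'I_n => (u, v) \in G.

Lemma is_dsgraphP n (G : {set 'I_n * 'I_n}) :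
  reflect [/\ (0 < n)%N, forall x y, connect (und G) x y &
             forall x y, (x, y) \in G -> ~~ connect (edg G) y x] (is_dsgraph G).
Proof.
apply: (iffP and3P) => [] [h0 h1 h2]; split=> //.
- by move=> x y; move/forallP/(_ x)/forallP/(_ y): h1.
- by move=> x y; move/forallP/(_ x)/forallP/(_ y)/implyP: h2.
- by apply/forallP=> x; apply/forallP=> y; apply: h1.
- by apply/forallP=> x; apply/forallP=> y; apply/implyP; apply: h2.
Qed.

Lemma dsgraph_loopless n (G : {set 'I_n * 'I_n}) : is_dsgraph G -> loopless G.
Proof.
by move=> /is_dsgraphP[_ _ h] x; apply/negP => /h; rewrite connect0.
Qed.

Lemma dsgraph_asym n (G : {set 'I_n * 'I_n}) x y :
  is_dsgraph G -> (x, y) \in G -> (y, x) \in G -> False.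
Proof.
by move=> /is_dsgraphP[_ _ h] /h /negP hn h2; apply: hn; apply: connect1.
Qed.

Lemma connect_map (T U : finType) (f : T -> U) (a : rel T) (b : rel U) x y :
  (forall u v, a u v -> connect b (f u) (f v)) -> connect a x y ->
  connect b (f x) (f y).
Proof.
move=> h /connectP[p]; elim: p x => [|z p IH] x /=; first by move=> _ ->.
by case/andP=> /h hxz /IH{}IH /IH; apply: connect_trans.
Qed.

Lemma und_sym n (G : {set 'I_n * 'I_n}) : connect_sym (und G).
Proof. by apply: sym_connect_sym => x y; rewrite /und orbC. Qed.

Lemma is_dsgraph0 : @is_dsgraph 1 set0.
Proof.
by apply/is_dsgraphP; split=> // x y; [rewrite !ord1 connect0|rewrite inE].
Qed.

Lemma dsgraph1 (G : {set 'I_1 * 'I_1}) : loopless G -> G = set0.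
Proof.
move=> h; apply: setP2 => x y; rewrite inE !ord1; split=> // h2.
by move: (h ord0); rewrite h2.
Qed.

Lemma is_dsgraph_relabel_sub n (s : 'S_n) (G : {set 'I_n * 'I_n}) :
  is_dsgraph G -> is_dsgraph (relabel s G).
Proof.
move=> /is_dsgraphP[h0 h1 h2]; apply/is_dsgraphP; split=> //.
  move=> x y; rewrite -(permK s x) -(permK s y).
  apply: (connect_map (f := s^-1%g) (a := und G)); last exact: h1.
  by move=> u v huv; apply: connect1; rewrite /und !inE /= !permKV.
move=> x y; rewrite inE /= => /h2 hn; apply: contra hn.
apply: (connect_map (f := s)) => u v huv; apply: connect1.
by move: huv; rewrite /edg inE.
Qed.

Lemma relabelM n (s t : 'S_n) (G : {set 'I_n * 'I_n}) :
  relabel t (relabel s G) = relabel (t * s)%g G.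
Proof. by apply: setP2 => x y; rewrite !inE /= !permM. Qed.

Lemma relabel1 n (G : {set 'I_n * 'I_n}) : relabel 1%g G = G.
Proof. by apply: setP2 => x y; rewrite !inE /= !perm1. Qed.

Lemma is_dsgraph_relabel n (s : 'S_n) (G : {set 'I_n * 'I_n}) :
  is_dsgraph (relabel s G) = is_dsgraph G.
Proof.
apply/idP/idP; last exact: is_dsgraph_relabel_sub.
move/(is_dsgraph_relabel_sub s^-1%g).
by rewrite relabelM mulVg relabel1.
Qed.

Section Block.
Variables (m n r : nat) (e : r.+1 = (m + n)%N) (i : 'I_m).
Local Notation pr := (@proj m n r i).
Local Notation io := (inn e i).

Lemma is_dsgraph_contr_restr (H : {set 'I_r * 'I_r}) :
  loopless H -> is_dsgraph (contr pr H) -> is_dsgraph (restr io H) ->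
  is_dsgraph H.
Proof.
move=> hl /is_dsgraphP[m0 mc ma] /is_dsgraphP[n0 nc na].
have step u v : (u, v) \in H -> connect (edg (contr pr H)) (pr u) (pr v).
  move=> huv; have [->|/eqP hn] := eqVneq (pr u) (pr v); first exact: connect0.
  by apply: connect1; apply/contrP; split=> //; exists u, v.
have blockc x y : pr x = pr y -> connect (und H) x y.
  have [hx E|hx /(proj_inj e hx) ->] := eqVneq (pr x) i; last exact: connect0.
  have [b ->] := proj_eq e hx; rewrite hx in E.
  have [c ->] := proj_eq e (esym E).
  apply: (connect_map (f := io) (a := und (restr io H))); last exact: nc.
  by move=> u v huv; apply: connect1; move: huv; rewrite /und !restrE.
apply/is_dsgraphP; split=> [|x y|x y hxy].
- by case: r e (m0) (n0) => //; lia.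
- have /connectP[p] := mc (pr x) (pr y).
  elim: p x => [|z p IH] x /=; first by move=> _ /esym/blockc.
  case/andP=> hxz hp hl'.
  have [x' [z' [hx' hz' hH]]] :
    exists x' z', [/\ pr x' = pr x, pr z' = z & und H x' z'].
    case/orP: hxz => /contrP[_ [u [v [hu hv huv]]]].
      by exists u, v; rewrite /und huv.
    by exists v, u; rewrite /und huv orbT.
  apply: (connect_trans (blockc x x' (esym hx'))).
  apply: (connect_trans (connect1 hH)); apply: IH.
    by rewrite hz'.
  by rewrite hz'.
- apply/negP => hyx.
  have hc u v : connect (edg H) u v -> connect (edg (contr pr H)) (pr u) (pr v).
    by apply: connect_map => *; apply: step.
  have [E|/eqP hn] := eqVneq (pr x) (pr y); last first.
    have /ma/negP : (pr x, pr y) \in contr pr H.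
      by apply/contrP; split=> //; exists x, y.
    by apply; apply: hc.
  have [hx|hx] := eqVneq (pr x) i; last first.
    by move: (hl y); rewrite -{1}(proj_inj e hx E) hxy.
  have [b eb] := proj_eq e hx; rewrite hx in E.
  have [c ec] := proj_eq e (esym E).
  have hbc : (b, c) \in restr io H by rewrite restrE -eb -ec.
  apply/negP: (na _ _ hbc); rewrite negbK.
  move: hyx; rewrite eb ec => {E hbc hxy hx eb ec y x}.
  case/connectP=> p; elim: p c => [|z p IH] c /=.
    by move=> _ /inn_inj ->; apply: connect0.
  case/andP=> hcz hp hb.
  have [hz|hz] := eqVneq (pr z) i.
    have [d ed] := proj_eq e hz; subst z.
    apply: connect_trans (IH d hp hb); apply: connect1.
    by rewrite /edg restrE.
  have /ma/negP[] : (i, pr z) \in contr pr H.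
    apply/contrP; split; first by move=> E; rewrite -E eqxx in hz.
    by exists (io c), z; rewrite proj_inn.
have := hc z (io b); rewrite proj_inn; apply; apply/connectP; by exists p.
Qed.

Variables (G1 : {set 'I_m * 'I_m}) (G2 : {set 'I_n * 'I_n}).
Hypotheses (h1 : is_dsgraph G1) (h2 : is_dsgraph G2).

Lemma insertE S (x y : 'I_r) :
  ((x, y) \in insert_graph r i G1 G2 S) =
  match place n i x, place n i y with
  | inl j, inl j' => (j, j') \in G1
  | inl j, inr b => ((j, i) \in G1) && (b \in S j)
  | inr b, inl j => ((i, j) \in G1) && (b \in S j)
  | inr b, inr b' => (b, b') \in G2
  end.
Proof. by rewrite inE. Qed.

Lemma loopless_insert S : loopless (insert_graph r i G1 G2 S).
Proof.
move=> x; rewrite insertE; case: (place n i x) => j.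
  exact: dsgraph_loopless.
exact: dsgraph_loopless.
Qed.

Lemma restr_insert S : restr io (insert_graph r i G1 G2 S) = G2.
Proof. by apply: setP2 => x y; rewrite restrE insertE !place_inn. Qed.

Lemma contr_insert S : attaching G1 i S ->
  contr pr (insert_graph r i G1 G2 S) = G1.
Proof.
move=> /forallP hS; apply: setP2 => u v; split.
  case/contrP=> huv [x [y [hx hy]]]; rewrite insertE.
  case Ex : (place n i x) => [j|b]; case Ey : (place n i y) => [j'|b'].
  - case/(place_inl e): Ex => <- _; case/(place_inl e): Ey => <- _.
    by rewrite hx hy.
  - case/(place_inl e): Ex => <- _; move/(place_inr e): Ey hy => ->.
    by rewrite proj_inn hx => -> /andP[].
  - case/(place_inl e): Ey => <- _; move/(place_inr e): Ex hx => ->.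
    by rewrite proj_inn hy => -> /andP[].
  - move: huv; rewrite -hx -hy; move/(place_inr e): Ex => ->.
    by move/(place_inr e): Ey => ->; rewrite !proj_inn.
move=> huv; apply/contrP; split.
  by move=> E; move: (dsgraph_loopless h1 v); rewrite -{1}E huv.
have [Eu|hu] := eqVneq u i.
  have hv : v != i.
    by apply/eqP=> E; move: (dsgraph_loopless h1 v); rewrite {1}E -Eu huv.
  have [y hy] := proj_surj e hv.
  have /set0Pn[b hb] : S v != set0 by rewrite (eqP (hS v)) -Eu huv orbT.
  exists (io b), y; rewrite proj_inn hy insertE place_inn.
  have -> : place n i y = inl v by apply/(place_inl e).
  by rewrite hb -Eu huv.
have [x hx] := proj_surj e hu.
have Px : place n i x = inl u by apply/(place_inl e).
have [Ev|hv] := eqVneq v i.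
  have /set0Pn[b hb] : S u != set0 by rewrite (eqP (hS u)) -Ev huv.
  by exists x, (io b); rewrite proj_inn hx insertE place_inn Px hb -Ev huv.
have [y hy] := proj_surj e hv.
have Py : place n i y = inl v by apply/(place_inl e).
by exists x, y; rewrite hx hy insertE Px Py huv.
Qed.

Lemma is_dsgraph_insert S : attaching G1 i S ->
  is_dsgraph (insert_graph r i G1 G2 S).
Proof.
move=> hS; apply: is_dsgraph_contr_restr; first exact: loopless_insert.
  by rewrite contr_insert.
by rewrite restr_insert.
Qed.

Definition attach_of (H : {set 'I_r * 'I_r}) : {ffun 'I_m -> {set 'I_n}} :=
  [ffun j => [set b | [exists x, (place n i x == inl j) && und H x (io b)]]].

Lemma attach_ofP H j b :
  reflect (exists2 x, place n i x = inl j & und H x (io b)) (b \in attach_of H j).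
Proof.
rewrite ffunE inE; apply: (iffP existsP) => [[x /andP[/eqP h h']]|[x h h']].
  by exists x.
by exists x; rewrite h eqxx.
Qed.

Lemma insert_eq (H : {set 'I_r * 'I_r}) S : loopless H ->
  (attaching G1 i S && (H == insert_graph r i G1 G2 S)) =
  (S == attach_of H) && ((contr pr H == G1) && (restr io H == G2)).
Proof.
move=> hl; apply/andP/andP.
  case=> hS /eqP E; subst H; rewrite contr_insert // restr_insert !eqxx.
  split=> //; apply/eqP/ffunP=> j; apply/setP=> b; apply/idP/attach_ofP.
    move=> hb.
    have hadj : ((j, i) \in G1) || ((i, j) \in G1).
      rewrite -(eqP (forallP hS j)); apply/set0Pn; by exists b.
    have hj : j != i.
      apply/eqP=> E; move: hadj; rewrite E orbb.
      by apply/negP; apply: dsgraph_loopless.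
    have [x hx] := proj_surj e hj; exists x; first exact/(place_inl e).
    rewrite /und !insertE place_inn.
    have -> : place n i x = inl j by apply/(place_inl e).
    by rewrite hb !andbT.
  by case=> x hx; rewrite /und !insertE place_inn hx => /orP[] /andP[].
case=> /eqP -> /andP[/eqP hc /eqP hr].
have P1 x y : (x, y) \in H -> pr x <> pr y -> (pr x, pr y) \in G1.
  by move=> h h'; rewrite -hc; apply/contrP; split=> //; exists x, y.
split.
  apply/forallP=> j; apply/eqP; apply/set0Pn/orP.
    case=> b /attach_ofP[x /(place_inl e) [hx hj] /orP[] hxb].
      left; have := P1 _ _ hxb; rewrite hx proj_inn; apply.
      by move/eqP: hj.
    right; have := P1 _ _ hxb; rewrite hx proj_inn; apply.
    by apply/eqP; rewrite eq_sym.
  case; rewrite -hc => /contrP[hj [x [y [hx hy hxy]]]].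
    have [b eb] := proj_eq e hy; exists b; apply/attach_ofP; exists x.
      by apply/(place_inl e); split=> //; apply/eqP.
    by rewrite /und -eb hxy.
  have [b eb] := proj_eq e hx; exists b; apply/attach_ofP; exists y.
    by apply/(place_inl e); split=> //; apply/eqP => E; apply: hj.
  by rewrite /und -eb hxy orbT.
apply/eqP; apply: setP2 => x y; rewrite insertE.
have uniqx (x1 : 'I_r) j : place n i x1 = inl j ->
    forall x2 : 'I_r, place n i x2 = inl j -> x2 = x1.
  by move=> E x2 E'; apply: (place_inj e (i := i)); rewrite E E'.
case Ex : (place n i x) => [j|b]; case Ey : (place n i y) => [j'|b'].
- have [ex hj] := (iffLR (place_inl e i x j) Ex).
  have [ey hj'] := (iffLR (place_inl e i y j') Ey).
  rewrite -hc; split.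
    move=> h; apply/contrP; split; last by exists x, y.
    move=> E; have := uniqx _ _ Ey x; rewrite -E => /(_ Ex) exy.
    by move: (hl y); rewrite -{1}exy h.
  case/contrP=> _ [x' [y' [hx' hy' h]]].
  rewrite (@proj_inj m n r e i x x') ?ex ?hx' //.
  by rewrite (@proj_inj m n r e i y y') ?ey ?hy'.
- have [ex hj] := (iffLR (place_inl e i x j) Ex).
  have ey := (iffLR (place_inr e i y b') Ey).
  have hp : pr x <> pr y by rewrite ex ey proj_inn; apply/eqP.
  split.
    move=> h; have := P1 _ _ h hp; rewrite ex {1}ey proj_inn => -> /=.
    by apply/attach_ofP; exists x => //; rewrite /und -ey h.
  case/andP=> hji /attach_ofP[x' hx'].
  rewrite (uniqx _ _ Ex _ hx') -ey => /orP[] // h.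
  have := P1 _ _ h (fun E => hp (esym E)); rewrite ex {1}ey proj_inn => hij.
  by case: (dsgraph_asym h1 hij hji).
- have [ey hj] := (iffLR (place_inl e i y j') Ey).
  have ex := (iffLR (place_inr e i x b) Ex).
  have hp : pr x <> pr y.
    by rewrite ey ex proj_inn; apply/eqP; rewrite eq_sym.
  split.
    move=> h; have := P1 _ _ h hp; rewrite ey {1}ex proj_inn => -> /=.
    by apply/attach_ofP; exists y => //; rewrite /und -ex h orbT.
  case/andP=> hji /attach_ofP[x' hx'].
  rewrite (uniqx _ _ Ey _ hx') -ex => /orP[] // h.
  have := P1 _ _ h (fun E => hp (esym E)); rewrite ey {1}ex proj_inn => hij.
  by case: (dsgraph_asym h1 hij hji).
- have ey := (iffLR (place_inr e i y b') Ey).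
  have ex := (iffLR (place_inr e i x b) Ex).
  by rewrite ex ey -hr restrE.
Qed.

End Block.
End IsDsgraph.

Local Ltac lia_if :=
  repeat (match goal with
  | |- context [if (?a < ?b)%N then _ else _] =>
    match a with
    | context [if _ then _ else _] => fail 1
    | _ => case: (ltnP a b) => ?
    end
  end); lia.

Section LieGra.
Variable k : fieldType.
Local Notation lie_gra n := {ffun dsGra n -> k^o}.

(* The basis vector of [k dsGra(n)] given by [G]; only used for [G] in
   [dsGra n], see [is_dsgraph0], [is_dsgraph_relabel], [is_dsgraph_insert]. *)
Definition graph_vec (n : nat) (G : {set 'I_n * 'I_n}) : lie_gra n :=
  [ffun h : dsGra n => (val h == G)%:R].

Definition lg_unit : lie_gra 1 := graph_vec set0.

Definition lg_act (n : nat) (s : 'S_n) (a : lie_gra n) : lie_gra n :=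
  \sum_(g : dsGra n) a g *: graph_vec (relabel s (val g)).

Definition lg_comp (m n r : nat) (e : r.+1 = (m + n)%N) (i : 'I_m)
    (a : lie_gra m) (b : lie_gra n) : lie_gra r :=
  \sum_(g1 : dsGra m) \sum_(g2 : dsGra n)
    ((a g1 : k) * (b g2 : k)) *:
    \sum_(S : {ffun 'I_m -> {set 'I_n}} | attaching (val g1) i S)
      graph_vec (insert_graph r i (val g1) (val g2) S).

Definition ext n (a : lie_gra n) (G : {set 'I_n * 'I_n}) : k :=
  if insub G is Some g then a g else 0.

Lemma ext_val n (a : lie_gra n) (g : dsGra n) : ext a (val g) = a g.
Proof. by rewrite /ext valK. Qed.

Lemma ext_out n (a : lie_gra n) G : ~~ is_dsgraph G -> ext a G = 0.
Proof. by rewrite /ext => h; rewrite insubN. Qed.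

Lemma ext_in n (a : lie_gra n) G (h : is_dsgraph G) :
  ext a G = a (exist _ G h).
Proof. by rewrite -ext_val. Qed.

Lemma ext_lin n (c : k) (a b : lie_gra n) G :
  ext (c *: a + b) G = c * ext a G + ext b G.
Proof.
by rewrite /ext; case: insub => [g|]; rewrite ?ffunE // mulr0 addr0.
Qed.

Lemma extP n (a b : lie_gra n) :
  (forall g : dsGra n, ext a (val g) = ext b (val g)) -> a = b.
Proof. by move=> h; apply/ffunP=> g; rewrite -!ext_val. Qed.

Lemma sum_ext n (a : lie_gra n) (G : {set 'I_n * 'I_n}) :
  \sum_(g : dsGra n) (a g : k) * (G == val g)%:R = ext a G.
Proof.
have [h|h] := boolP (is_dsgraph G); last first.
  rewrite ext_out // big1 // => g _; case: eqP => [E|_]; rewrite ?mulr0 //.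
  by move: h; rewrite E (valP g).
rewrite (bigD1 (exist _ G h : dsGra n)) //= eqxx mulr1 big1 ?addr0 -?ext_in //.
move=> g hg; rewrite (_ : G == val g = false) ?mulr0 //.
by apply/eqP=> E; case/eqP: hg; apply: val_inj.
Qed.

Lemma ext_unit G : loopless G -> ext (lg_unit) G = 1.
Proof.
by move=> h; rewrite (dsgraph1 h) (ext_in _ is_dsgraph0) ffunE eqxx.
Qed.

Lemma ext_act n (s : 'S_n) (a : lie_gra n) G :
  ext (lg_act s a) G = ext a (relabel s^-1%g G).
Proof.
have [h|h] := boolP (is_dsgraph G); last first.
  by rewrite !ext_out // is_dsgraph_relabel.
rewrite ext_in /lg_act sum_ffunE -sum_ext; apply: eq_bigr => g _.
rewrite !ffunE /=; congr (_ * (_ : bool)%:R).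
by apply/eqP/eqP => [->|<-]; rewrite relabelM ?mulgV ?mulVg relabel1.
Qed.

Lemma sum_attaching m n r (e : r.+1 = (m + n)%N) (i : 'I_m)
  (g1 : dsGra m) (g2 : dsGra n) (h : dsGra r) :
  \sum_(S : {ffun 'I_m -> {set 'I_n}} | attaching (val g1) i S)
     (val h == insert_graph r i (val g1) (val g2) S)%:R =
  (contr (@proj m n r i) (val h) == val g1)%:R *
  (restr (inn e i) (val h) == val g2)%:R :> k.
Proof.
have hl := dsgraph_loopless (valP h).
rewrite big_mkcond /=.
have E S := insert_eq e i (val g2) (valP g1) S hl.
rewrite (bigD1 (attach_of e i (val h))) //= big1 ?addr0 => [|S hS].
  move: (E (attach_of e i (val h))); rewrite eqxx /= -natrM mulnb => <-.
  by case: attaching.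
by move: (E S); rewrite (negbTE hS) /=; case: attaching => //= ->.
Qed.

Lemma ext_comp m n r (e : r.+1 = (m + n)%N) (i : 'I_m)
  (a : lie_gra m) (b : lie_gra n) G : loopless G ->
  ext (lg_comp e i a b) G =
  ext a (contr (@proj m n r i) G) * ext b (restr (inn e i) G).
Proof.
move=> hl; have [h|h] := boolP (is_dsgraph G); last first.
  rewrite ext_out //.
  have [h1|h1] := boolP (is_dsgraph (contr (@proj m n r i) G)); last first.
    by rewrite (ext_out a h1) mul0r.
  have [h2|h2] := boolP (is_dsgraph (restr (inn e i) G)); last first.
    by rewrite (ext_out b h2) mulr0.
  by move: h; rewrite (is_dsgraph_contr_restr hl h1 h2).
rewrite ext_in /lg_comp sum_ffunE -2!sum_ext mulr_suml.
apply: eq_bigr => g1 _; rewrite sum_ffunE mulr_sumr; apply: eq_bigr => g2 _.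
rewrite !ffunE /= sum_ffunE /=.
rewrite -[RHS]mulrACA -(sum_attaching e i g1 g2 (exist _ G h)); congr (_ * _).
by apply: eq_bigr => S _; rewrite ffunE.
Qed.

Lemma lg_act_linear n (s : 'S_n) : linear (@lg_act n s).
Proof. by move=> c a b; apply: extP => g; rewrite ext_lin !ext_act ext_lin. Qed.

Lemma lg_act1 n (a : lie_gra n) : lg_act 1%g a = a.
Proof. by apply: extP => g; rewrite ext_act invg1 relabel1. Qed.

Lemma lg_actM n (s t : 'S_n) (a : lie_gra n) :
  lg_act t (lg_act s a) = lg_act (t * s)%g a.
Proof. by apply: extP => g; rewrite !ext_act relabelM invMg. Qed.

Definition lie_gra_smodule : smodule k :=
  @SModule k (fun n => lie_gra n : lmodType k) (@lg_act)
    lg_act_linear lg_act1 lg_actM.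

Lemma lg_comp_linearl m n r (e : r.+1 = (m + n)%N) (i : 'I_m)
  (b : lie_gra_smodule n) :
  linear (fun a : lie_gra_smodule m => lg_comp e i a b : lie_gra_smodule r).
Proof.
move=> c x y; apply: extP => g; have hl := dsgraph_loopless (valP g).
by rewrite ext_lin !ext_comp // ext_lin mulrDl mulrA.
Qed.

Lemma lg_comp_linearr m n r (e : r.+1 = (m + n)%N) (i : 'I_m)
  (a : lie_gra_smodule m) :
  linear (lg_comp e i a : lie_gra_smodule n -> lie_gra_smodule r).
Proof.
move=> c x y; apply: extP => g; have hl := dsgraph_loopless (valP g).
by rewrite ext_lin !ext_comp // ext_lin mulrDr mulrCA.
Qed.

Lemma lg_unitl n (e : n.+1 = (1 + n)%N) (i : 'I_1) (a : lie_gra n) :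
  lg_comp e i (lg_unit) a = a.
Proof.
apply: extP => g; have hl := dsgraph_loopless (valP g).
rewrite ext_comp // ext_unit ?mul1r; last exact: loopless_contr.
congr ext; apply: setP2 => x y; rewrite restrE.
have E z : inn e i z = z by apply: val_inj; rewrite /= (ord1 i).
by rewrite !E.
Qed.

Lemma lg_unitr m (e : m.+1 = (m + 1)%N) (i : 'I_m) (a : lie_gra m) :
  lg_comp e i a (lg_unit) = a.
Proof.
apply: extP => g; have hl := dsgraph_loopless (valP g).
rewrite ext_comp // ext_unit ?mulr1; last exact: loopless_restr.
congr ext; apply: contr_id => // x.
apply: val_inj; rewrite /= (proj_val e).
by case: (ltnP x i); case: (ltnP x (i + 1)%N); lia.
Qed.

Lemma lg_sequential m n p r q t (e1 : r.+1 = (m + n)%N)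
  (e2 : t.+1 = (r + p)%N) (e3 : q.+1 = (n + p)%N) (e4 : t.+1 = (m + q)%N)
  (i : 'I_m) (j : 'I_n) (j' : 'I_r)
  (a : lie_gra m) (b : lie_gra n) (c : lie_gra p) :
  j' = (i + j)%N :> nat ->
  lg_comp e2 j' (lg_comp e1 i a b) c = lg_comp e4 i a (lg_comp e3 j b c).
Proof.
move=> hj; apply: extP => g; have hl := dsgraph_loopless (valP g).
rewrite !ext_comp //; [|exact: loopless_restr|exact: loopless_contr].
have hjn := ltn_ord j.
rewrite -mulrA; congr (ext a _ * (ext b _ * ext c _)).
- apply: contr_comp => x; apply: val_inj; rewrite /= (proj_val e1) (proj_val e2).
  rewrite (proj_val e4) hj.
  by lia_if.
- apply: restr_contr; first exact: inn_inj.
    move=> x; apply: val_inj; rewrite /= (proj_val e2) (proj_val e3) /= hj.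
    by lia_if.
  move=> x y /(congr1 val); rewrite /= (proj_val e2) hj => E.
  have h : (x - i < q)%N.
    by have := ltn_ord y; move: E; lia_if.
  exists (Ordinal h); apply: val_inj => /=.
  by move: E; lia_if.
- by rewrite (restr_comp (h := inn e2 j')) // => x; apply: val_inj => /=; lia.
Qed.

Lemma lg_parallel m n p r q t (e1 : r.+1 = (m + n)%N)
  (e2 : t.+1 = (r + p)%N) (e3 : q.+1 = (m + p)%N) (e4 : t.+1 = (q + n)%N)
  (i j : 'I_m) (j' : 'I_r) (i' : 'I_q)
  (a : lie_gra m) (b : lie_gra n) (c : lie_gra p) :
  (i < j)%N -> j'.+1 = (j + n)%N -> i' = i :> nat ->
  lg_comp e2 j' (lg_comp e1 i a b) c = lg_comp e4 i' (lg_comp e3 j a c) b.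
Proof.
move=> hij hj hi; apply: extP => g; have hl := dsgraph_loopless (valP g).
rewrite !ext_comp //; try exact: loopless_contr.
rewrite mulrAC; congr (ext a _ * ext c _ * ext b _).
- rewrite (contr_comp (h := fun x => proj n i (proj p j' x))) //.
  symmetry; apply: contr_comp => x; apply: val_inj.
  rewrite /= (proj_val e1) (proj_val e2) (proj_val e3) (proj_val e4) hi.
  by lia_if.
- rewrite [RHS](restr_contr (f' := id) (g' := inn e2 j')).
  + by rewrite contr_id //; apply: loopless_restr.
  + exact: inn_inj.
  + move=> x; apply: val_inj; rewrite /= (proj_val e4) /= hi.
    by lia_if.
  + move=> x y /(congr1 val); rewrite /= (proj_val e4) hi => E.
    exists y; apply: val_inj => /=.
    by move: E; lia_if.
- rewrite (restr_contr (f' := id) (g' := inn e4 i')).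
  + by rewrite contr_id //; apply: loopless_restr.
  + exact: inn_inj.
  + move=> x; have := ltn_ord x; move=> hx.
    apply: val_inj; rewrite /= (proj_val e2) /= hi.
    by lia_if.
  + move=> x y; have := ltn_ord y => hy.
    move=> /(congr1 val); rewrite /= (proj_val e2) => E.
    exists y; apply: val_inj; rewrite /= hi.
    by move: E; lia_if.
Qed.

Lemma lg_equivariant m n r (e : r.+1 = (m + n)%N) (i : 'I_m)
  (s : 'S_m) (t : 'S_n) (rho : 'S_r) (a : lie_gra m) (b : lie_gra n) :
  is_block_perm i s t rho ->
  lg_comp e i (lg_act s a) (lg_act t b) = lg_act rho (lg_comp e (s i) a b).
Proof.
move=> hb; apply: extP => g; have hl := dsgraph_loopless (valP g).
have hl' : loopless (relabel rho^-1%g (val g)).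
  by apply: dsgraph_loopless; rewrite is_dsgraph_relabel (valP g).
have prho x : proj n (s i) (rho x) = s (proj n i x).
  by rewrite /proj hb; case: (place n i x).
have irho x : rho (inn e i x) = inn e (s i) (t x).
  by apply/(place_inr e); rewrite hb place_inn.
rewrite ext_act !ext_comp // !ext_act; congr (ext a _ * ext b _).
- apply: setP2 => u v; rewrite inE /=; split=> /contrP[huv [x [y [hx hy hG]]]].
    apply/contrP; split; first by move=> E; apply: huv; rewrite E.
    exists (rho x), (rho y); rewrite !prho hx hy !permKV inE /= !permK.
    by split.
  apply/contrP; split; first by move/perm_inj.
  exists (rho^-1 x)%g, (rho^-1 y)%g.
  rewrite inE /= in hG; split=> //; apply: (@perm_inj _ s).
    by rewrite -prho !permKV.
  by rewrite -prho !permKV.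
- apply: setP2 => u v; rewrite !inE /=.
  have E w : inn e i (t^-1%g w) = rho^-1%g (inn e (s i) w).
    by apply: (@perm_inj _ rho); rewrite irho !permKV.
  by rewrite !E.
Qed.

Definition Lie_gra : operad k :=
  @Operad k lie_gra_smodule (lg_unit) (@lg_comp)
    lg_comp_linearl lg_comp_linearr lg_unitl lg_unitr
    lg_sequential lg_parallel lg_equivariant.

End LieGra.

(* Main.v *)
Require Import Defs.
From mathcomp Require Import all_boot all_fingroup all_algebra.
From mathcomp Require Import zify.
Import GRing.Theory.
Local Open Scope ring_scope.

Set Implicit Arguments.
Unset Strict Implicit.
Unset Printing Implicit Defensive.

(** In each arity [n >= 2] there is a nonzero linear form on [Lie_gra k n] which
    vanishes on all composites of operations of arities at least 2, even after
    permuting labels.  So new generators are needed in every arity, whereas an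
    [E] of finite total dimension vanishes in large arities.

    The form is [chain_sum].  It sums the coefficients of the graphs on
    [0, ..., n - 1] that contain the path [0 -> 1 -> ... -> n - 1] and whose
    edges all increase the labels, the graph [G] being counted with the sign
    [(-1) ^+ #|G|].  By [ext_comp], the coefficient of [G] in [a o_i b] is the
    coefficient in [a] of the graph obtained by contracting a certain block [B]
    of vertices of [G], times the coefficient in [b] of the restriction of [G]
    to [B]; here [B] has at least two elements and is not everything.  Let [lo]
    and [hi] be the least and the greatest elements of [B].
    - If [lo > 0], the edge from [lo - 1] to [hi] is not on the path and can be
      added to or removed from [G].  This leaves the restriction to [B]
      unchanged as [lo - 1] is not in [B], and leaves the contraction unchanged
      as the edge from [lo - 1] to [lo], which belongs to [G], has the same
      image.  The terms therefore cancel in pairs.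
    - If [hi < n - 1], the edge from [lo] to [hi + 1] plays the same role.
    - Otherwise [B] contains 0 and [n - 1] but misses some vertex in between,
      and contracting it turns the path into a directed cycle: every term is
      zero.
    This is [chain_sum_comp].  By induction on expressions in the generators,
    [chain_null_eval], the form then vanishes on the value of every expression
    of large arity, while it is nonzero on the tournament of all increasing
    edges, [tournament_not_chain_null]. *)

(** * Cancellation by toggling an element *)

Lemma alternating_sum_toggle (R : pzRingType) (T : finType) (x : T)
    (P : pred {set T}) (F : {set T} -> R) :
  (forall G, P (x |: G) = P G) ->
  (forall G, P G -> x \notin G -> F (x |: G) = F G) ->
  \sum_(G | P G) (-1) ^+ #|G| * F G = 0.
Proof.
move=> hP hF; rewrite (bigID (fun G : {set T} => x \in G)) /=.
rewrite (reindex_onto (fun G => x |: G) (fun G => G :\ x)) /=; last first.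
  by move=> G /andP[_ hx]; rewrite setD1K.
rewrite (eq_bigl (fun G => P G && (x \notin G))) => [|G]; last first.
  rewrite hP setU11 andbT; congr (_ && _).
  have [hx|hx] := boolP (x \in G); last by rewrite setU1K // eqxx.
  by apply/eqP => /setP/(_ x); rewrite setD11 hx.
rewrite -big_split big1 //= => G /andP[hG hx].
by rewrite hF // cardsU1 hx exprS mulN1r mulNr addNr.
Qed.

(** * Edges that contraction and restriction do not see *)

Lemma contr_setU1 p q (f : 'I_p -> 'I_q) (H : {set 'I_p * 'I_p}) x y x' y' :
  (x', y') \in H -> f x' = f x -> f y' = f y ->
  contr f ((x, y) |: H) = contr f H.
Proof.
move=> h hx hy; apply: setP2 => u v; split=> /contrP[huv [a [b [ha hb]]]].
  case/setU1P=> [[ea eb]|hab]; apply/contrP; split=> //.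
    by exists x', y'; rewrite hx hy -ea -eb.
  by exists a, b.
by move=> hab; apply/contrP; split=> //; exists a, b; rewrite inE hab orbT.
Qed.

Lemma restr_setU1 p q (f : 'I_q -> 'I_p) (H : {set 'I_p * 'I_p}) x y :
  (forall u, f u = x -> forall v, f v = y -> False) ->
  restr f ((x, y) |: H) = restr f H.
Proof.
move=> h; apply: setP2 => u v; rewrite !restrE !inE.
split=> [/orP[/eqP[hu hv]|//]|->].
  by case: (h u hu v hv).
by rewrite orbT.
Qed.

Lemma relabelV_setU1 n (s : 'S_n) (G : {set 'I_n * 'I_n}) x y :
  relabel s^-1%g ((x, y) |: G) = (s x, s y) |: relabel s^-1%g G.
Proof.
apply: setP2 => u v; rewrite !inE /= !xpair_eqE.
by rewrite -(inj_eq (@perm_inj _ s) _ x) -(inj_eq (@perm_inj _ s) _ y) !permKV.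
Qed.

(** * Increasing graphs containing the path through all vertices *)

Definition chain_graph n (G : {set 'I_n * 'I_n}) : bool :=
  [forall x, forall y, (((x, y) \in G) ==> (x < y)%N) &&
                       ((x.+1 == y :> nat) ==> ((x, y) \in G))].

Lemma chain_graphP n (G : {set 'I_n * 'I_n}) :
  reflect ((forall x y, (x, y) \in G -> (x < y)%N) /\
           (forall x y : 'I_n, x.+1 = y -> (x, y) \in G)) (chain_graph G).
Proof.
apply: (iffP forallP) => [h|[h1 h2] x].
  by split=> x y; have /forallP/(_ y)/andP[/implyP h1 /implyP h2] := h x;
     [exact: h1|move/eqP; exact: h2].
apply/forallP => y; apply/andP; split; apply/implyP; first exact: h1.
by move/eqP; apply: h2.
Qed.

(** The gap [x.+1 < y] keeps the edge off the path, so that chain graphs are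
    stable under removing it as well as under adding it. *)
Lemma chain_graph_setU1 n (G : {set 'I_n * 'I_n}) (x y : 'I_n) :
  (x.+1 < y)%N -> chain_graph ((x, y) |: G) = chain_graph G.
Proof.
move=> hxy; apply/chain_graphP/chain_graphP => -[h1 h2]; split=> u v.
- by move=> h; apply: h1; rewrite inE h orbT.
- by move=> E; have := h2 _ _ E; rewrite !inE => /orP[/eqP[eu ev]|//]; subst; lia.
- by rewrite !inE => /orP[/eqP[-> ->]|]; [lia|exact: h1].
- by move=> /h2; rewrite inE => ->; rewrite orbT.
Qed.

Lemma chain_connect n (G : {set 'I_n * 'I_n}) (x y : 'I_n) :
  chain_graph G -> (x <= y)%N -> connect (edg G) x y.
Proof.
move=> /chain_graphP[_ h2] hxy.
have [d hd] : exists d, (x + d = y)%N by exists (y - x)%N; lia.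
elim: d y hd {hxy} => [|d IH] y hd.
  by have -> : x = y; [apply: val_inj => /=; lia|exact: connect0].
have hz : (x + d < n)%N by have := ltn_ord y; lia.
apply: (connect_trans (IH (Ordinal hz) erefl)); apply: connect1.
by apply: h2 => /=; lia.
Qed.

Lemma dsgraph_connect_anti n (G : {set 'I_n * 'I_n}) x y :
  is_dsgraph G -> connect (edg G) x y -> connect (edg G) y x -> x = y.
Proof.
move=> /is_dsgraphP[_ _ h] /connectP[[|z p] /=]; first by move=> _ ->.
case/andP=> /h/negP hxz hp -> hy; case: hxz.
by apply: connect_trans hy; apply/connectP; exists p.
Qed.

(** Identifying the ends of a directed walk, but not its middle point, closes it
    into a directed cycle. *)
Lemma contr_walk_nondsgraph p q (f : 'I_p -> 'I_q) (H : {set 'I_p * 'I_p})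
    x y z :
  connect (edg H) x y -> connect (edg H) y z -> f x = f z -> f x <> f y ->
  ~~ is_dsgraph (contr f H).
Proof.
move=> hxy hyz hxz hn; apply/negP => hd; apply: hn.
have h u v : connect (edg H) u v -> connect (edg (contr f H)) (f u) (f v).
  apply: connect_map => a b hab.
  have [->|/eqP hn] := eqVneq (f a) (f b); first exact: connect0.
  by apply: connect1; apply/contrP; split=> //; exists a, b.
by apply: (dsgraph_connect_anti hd (h _ _ hxy)); rewrite hxz; apply: h.
Qed.

(** * The alternating sum over chain graphs *)

Lemma linear_scale (k : pzRingType) (U V : lmodType k) (f : U -> V) :
  linear f -> (forall c x, f (c *: x) = c *: f x) /\ f 0 = 0.
Proof.
move=> hf; have f0 : f 0 = 0.
  by have := hf (-1) 0 0; rewrite !scaleN1r !addNr.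
by split=> // c x; rewrite -[c *: x]addr0 hf f0 addr0.
Qed.

Section ChainSum.
Variable k : fieldType.

Definition chain_sum n (a : Lie_gra k n) : k :=
  \sum_(G : {set 'I_n * 'I_n} | chain_graph G) (-1) ^+ #|G| * ext a G.

Lemma chain_sum_linear n c (a b : Lie_gra k n) :
  chain_sum (c *: a + b) = c * chain_sum a + chain_sum b.
Proof.
rewrite /chain_sum mulr_sumr -big_split; apply: eq_bigr => G _ /=.
by rewrite ext_lin mulrDr mulrCA.
Qed.

(** After relabelling by [s], the block of [b] is an arbitrary set [B] of
    positions along the path, not necessarily an interval. *)
Lemma chain_sum_comp m n r (e : r.+1 = (m + n)%N) (i : 'I_m) (s : 'S_r)
    (a : Lie_gra k m) (b : Lie_gra k n) :
  (1 < m)%N -> (1 < n)%N -> chain_sum (sm_act s (op_comp e i a b)) = 0.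
Proof.
move=> hm hn.
pose X G := ext a (contr (@proj m n r i) (relabel s^-1%g G)) *
            ext b (restr (inn e i) (relabel s^-1%g G)).
have hX G : chain_graph G -> ext (sm_act s (op_comp e i a b) : Lie_gra k r) G = X G.
  case/chain_graphP=> hG _; rewrite ext_act ext_comp // => x.
  by rewrite inE /=; apply/negP => /hG; rewrite ltnn.
rewrite /chain_sum (eq_bigr (fun G : {set _} => (-1) ^+ #|G| * X G)); last first.
  by move=> G hG; rewrite hX.
pose B x := @proj m n r i (s x) == i.
have BP x u : inn e i u = s x -> B x by move=> h; rewrite /B -h proj_inn.
have [x1 [x2 [hx1 hx2 hx12]]] : exists x1 x2, [/\ B x1, B x2 & x1 != x2].
  exists (s^-1 (inn e i (Ordinal (ltnW hn))))%g, (s^-1 (inn e i (Ordinal hn)))%g.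
  split; rewrite ?/B ?permKV ?proj_inn //.
  by rewrite (inj_eq perm_inj) (inj_eq (@inn_inj _ _ _ e i)).
have [y hy] : exists y, ~~ B y.
  have [j hj] : exists j : 'I_m, j != i.
    have h0 : (0 < m)%N by exact: ltnW.
    have [E|] := eqVneq i (Ordinal h0); last by exists (Ordinal h0); rewrite eq_sym.
    by exists (Ordinal hm); rewrite E.
  have [z hz] := proj_surj e hj.
  by exists (s^-1 z)%g; rewrite /B permKV hz.
pose lo := [arg min_(x < x1 | B x) (x : nat)].
pose hi := [arg max_(x > x1 | B x) (x : nat)].
have [hlo lomin] : B lo /\ forall x, B x -> (lo <= x)%N.
  by rewrite /lo; case: arg_minnP.
have [hhi himax] : B hi /\ forall x, B x -> (x <= hi)%N.
  by rewrite /hi; case: arg_maxnP.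
have hlohi : (lo < hi)%N.
  move: (lomin _ hx1) (lomin _ hx2) (himax _ hx1) (himax _ hx2) hx12.
  by rewrite -val_eqE /=; lia.
have plo : @proj m n r i (s lo) = i by apply/eqP.
have phi : @proj m n r i (s hi) = i by apply/eqP.
(* The edge [(u', v')] of the path makes [(u, v)] invisible in the contraction;
   the restriction does not see [(u, v)] since one of its ends is outside [B]. *)
have toggle (u v u' v' : 'I_r) : (u.+1 < v)%N -> (u'.+1 = v')%N ->
    @proj m n r i (s u') = @proj m n r i (s u) ->
    @proj m n r i (s v') = @proj m n r i (s v) ->
    ~~ (B u && B v) ->
    \sum_(G | chain_graph G) (-1) ^+ #|G| * X G = 0.
  move=> huv huv' eu ev hB; apply: (@alternating_sum_toggle _ _ (u, v)) => G.
    exact: chain_graph_setU1.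
  case/chain_graphP=> _ hG _; rewrite /X relabelV_setU1.
  have hH : (s u', s v') \in relabel s^-1%g G.
    by rewrite inE /= !permK; apply: hG.
  rewrite (contr_setU1 hH eu ev) restr_setU1 // => w /BP hu w' /BP hv.
  by move: hB; rewrite hu hv.
have [lo0|lo0] := ltnP 0 lo.
  have ha : (lo.-1 < r)%N by have := ltn_ord lo; lia.
  pose a' : 'I_r := Ordinal ha.
  apply: (toggle a' hi a' lo) => /=; rewrite ?plo ?phi //; try lia.
  by apply/negP => /andP[/lomin /=]; lia.
have [hir|hir] := ltnP hi.+1 r.
  pose a' : 'I_r := Ordinal hir.
  apply: (toggle lo a' hi a') => /=; rewrite ?plo ?phi //.
  by apply/negP => /andP[_ /himax /=]; lia.
(* [B] contains both ends of the path, and [y] lies strictly between them. *)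
apply: big1 => G hG; rewrite /X [ext a _]ext_out ?mul0r ?mulr0 //.
have hc (x z : 'I_r) : (x <= z)%N -> connect (edg (relabel s^-1%g G)) (s x) (s z).
  move=> /(chain_connect hG); apply: connect_map => u v huv.
  by apply: connect1; rewrite /edg inE /= !permK.
apply: (contr_walk_nondsgraph (hc lo y _) (hc y hi _)).
- lia.
- by have := ltn_ord y; lia.
- by rewrite plo phi.
- by rewrite plo => /esym/eqP; apply/negP.
Qed.

(** All permutations are included so that the condition is stable under the
    action of the symmetric group, which [chain_sum] itself is not. *)
Definition chain_null n (a : Lie_gra k n) : Prop :=
  forall s : 'S_n, chain_sum (sm_act s a) = 0.

Lemma chain_null_linear n c (a b : Lie_gra k n) :
  chain_null a -> chain_null b -> chain_null (c *: a + b).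
Proof.
by move=> ha hb s; rewrite sm_act_linear chain_sum_linear ha hb mulr0 addr0.
Qed.

Lemma chain_null0 n : chain_null (0 : Lie_gra k n).
Proof.
move=> s; rewrite (linear_scale (sm_act_linear s)).2 /chain_sum big1 // => G _.
by rewrite /ext; case: insub => [g|]; rewrite ?ffunE mulr0.
Qed.

Lemma chain_nullZ n c (a : Lie_gra k n) : chain_null a -> chain_null (c *: a).
Proof.
move=> ha; rewrite -[_ *: _]addr0.
by apply: chain_null_linear => //; apply: chain_null0.
Qed.

Definition tournament n : {set 'I_n * 'I_n} :=
  [set p : 'I_n * 'I_n | (p.1 < p.2)%N].

Lemma chain_graph_tournament n : chain_graph (tournament n).
Proof. by apply/chain_graphP; split=> x y; rewrite inE //= => <-. Qed.

Lemma is_dsgraph_tournament n : is_dsgraph (tournament n.+1).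
Proof.
apply/is_dsgraphP; split=> // x y.
  have [->|hxy] := eqVneq x y; first exact: connect0.
  by apply: connect1; rewrite /und !inE /= -neq_ltn.
rewrite inE /= ltnNge; apply: contra => /connectP[p].
elim: p y => [|z p IH] y /=; first by move=> _ ->.
rewrite {1}/edg inE /= => /andP[/ltnW hyz hp] /(IH _ hp).
exact: leq_trans.
Qed.

Lemma tournament_not_chain_null n :
  ~ chain_null (graph_vec k (tournament n.+1) : Lie_gra k n.+1).
Proof.
move/(_ 1%g); rewrite sm_act1 /chain_sum (bigD1 (tournament n.+1)) /=; last first.
  exact: chain_graph_tournament.
rewrite (ext_in _ (is_dsgraph_tournament n)) ffunE eqxx mulr1 big1 ?addr0.
  by move/eqP; rewrite signr_eq0.
move=> G /andP[_ hG]; have [h|h] := boolP (is_dsgraph G); last first.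
  by rewrite ext_out ?mulr0.
by rewrite (ext_in _ h) ffunE /= (negbTE hG) mulr0.
Qed.

Lemma Lie_gra0 (a : Lie_gra k 0) : a = 0.
Proof. by apply/ffunP => -[G hG]; case/is_dsgraphP: (hG). Qed.

Lemma Lie_gra1 (a : Lie_gra k 1) : exists c : k, a = c *: op_unit (Lie_gra k).
Proof.
exists (ext a set0); apply: extP => -[G hG] /=.
have -> := dsgraph1 (dsgraph_loopless hG).
rewrite -[_ *: _]addr0 ext_lin ext_unit ?mulr1 => [|x]; last by rewrite inE.
by rewrite [ext 0 _]/ext; case: insub => [g|]; rewrite ?ffunE addr0.
Qed.

(** * Generation *)

(** The arities are bounded below by 2 because composites with the unit, or
    with its multiples that make up arity 1, are not decompositions; in such
    composites the other factor has the full arity and the induction hypothesis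
    applies to it.  Factors of arity 0 vanish, as graphs are non-empty. *)
Lemma chain_null_eval (E : smodule k) (f : smod_hom E (Lie_gra k)) (N : nat) :
  (0 < N)%N -> (forall n (x : E n), (N < n)%N -> x = 0) ->
  forall n (t : free_term E n), (N < n)%N -> chain_null (free_eval f t).
Proof.
move=> hN hE n t; elim: t => {n}.
- move=> n x hn; change (chain_null (f n x)).
  by rewrite (hE n x hn) (linear_scale (@sh_linear _ _ _ f n)).2; apply: chain_null0.
- by move=> h; move: hN; rewrite ltnNge; case: N h {hE} => [|[]].
- move=> m n r e i a IHa b IHb hr.
  change (chain_null (op_comp e i (free_eval f a) (free_eval f b))).
  case: m e i a IHa => [|[|m]] e i a IHa; first by case: i.
    have er : n = r by lia.
    subst n; have [c ->] := Lie_gra1 (free_eval f a).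
    rewrite (linear_scale (op_comp_linearl e i (free_eval f b))).1 op_unitl.
    exact/chain_nullZ/IHb.
  case: n e b IHb => [|[|n]] e b IHb; last by move=> s; apply: chain_sum_comp.
    rewrite (Lie_gra0 (free_eval f b)) (linear_scale (op_comp_linearr e i _)).2.
    exact: chain_null0.
  have er : m.+2 = r by lia.
  subst r; have [c ->] := Lie_gra1 (free_eval f b).
  rewrite (linear_scale (op_comp_linearr e i _)).1 op_unitr.
  exact/chain_nullZ/IHa.
- move=> n s t IH hn s'.
  change (chain_sum (sm_act s' (sm_act s (free_eval f t))) = 0).
  by rewrite sm_actM; apply: IH.
- by move=> n _; apply: chain_null0.
- move=> n a IHa b IHb hn; change (chain_null (free_eval f a + free_eval f b)).
  rewrite -[free_eval f a]scale1r.
  by apply: chain_null_linear; [apply: IHa|apply: IHb].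
- by move=> n c a IHa hn; apply/chain_nullZ/IHa.
Qed.

End ChainSum.

(** The composite of the projection from the free operad onto the quotient with
    the isomorphism is determined by its restriction to the generators, so it
    evaluates expressions; it is onto. *)
Lemma finitely_generated_eval (k : fieldType) (O : operad k) :
  finitely_generated O ->
  exists (E : smodule k) (f : smod_hom E O) (N : nat),
    (forall n (x : E n), (N < n)%N -> x = 0) /\
    (forall n (y : O n), exists t : free_term E n, free_eval f t = y).
Proof.
case=> E [R [[d [hd [N hN]]] [p [q pq]]]].
pose I := generated_ideal R.
pose h n (x : free_operad E n) : O n := q n (qpi I x).
have h_lin n : linear (@h n) by move=> c x y; rewrite /h qpi_linear sh_linear.
have h_act n (s : 'S_n) (x : free_operad E n) : h n (sm_act s x) = sm_act s (h n x).
  by rewrite /h -(sh_act q) -(qpi_act I).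
pose hs := @SmodHom k (free_operad E) O h h_lin h_act.
have h_unit : hs 1%N (op_unit (free_operad E)) = op_unit O by rewrite -(oh_unit q).
have h_comp m n r (e : r.+1 = (m + n)%N) (i : 'I_m) (a : free_operad E m)
    (b : free_operad E n) : hs r (op_comp e i a b) = op_comp e i (hs m a) (hs n b).
  by rewrite /= /h -(oh_comp q) -(qpi_comp I).
pose ho := @OperadHom k (free_operad E) O hs h_unit h_comp.
have f_lin n : linear (fun x : E n => ho n (free_gen E n x)).
  by move=> c x y; rewrite !sh_linear.
have f_act n (s : 'S_n) (x : E n) :
    ho n (free_gen E n (sm_act s x)) = sm_act s (ho n (free_gen E n x)).
  by rewrite !sh_act.
pose f := SmodHom f_lin f_act.
exists E, f, N; split=> [n x /hN d0|n y].
  case: (hd n); rewrite d0 => -[v _ v_bij].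
  by apply: (bij_inj v_bij); apply/rowP => -[].
exists (frepr (qrepr (p n y))).
rewrite -[RHS](pq n).1 -[p n y in RHS](qpiK (I := I)).
exact/esym/(free_lift_unique (f := f) (g := ho)).
Qed.

Theorem proposition1p13 (k : fieldType) (hk : [pchar k] =i pred0) :
  ~ finitely_generated (Lie_gra k).
Proof.
move=> /finitely_generated_eval[E [f [N [hE hf]]]].
(* [N.+1] and not [N], so that the arities considered are at least 2. *)
have hE' n (x : E n) : (N.+1 < n)%N -> x = 0 by move/ltnW; apply: hE.
have [t ht] := hf N.+2 (graph_vec k (tournament N.+2)).
apply: (@tournament_not_chain_null k N.+1); rewrite -ht.
exact: (@chain_null_eval k E f N.+1 (ltn0Sn N) hE' N.+2 t (ltnSn _)).
Qed.
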